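(* Let $k$ be a field with $\operatorname{char}(k)\neq 2$ and let $n\ge 1$. Then $\mathrm{GLIN}_n(k)$ contains $\mathrm{T}_n(k)$.
   Context: $\mathrm{GA}_n(k)$ is the group of polynomial automorphisms of $k[X_1,\ldots,X_n]$ ($k$-algebra automorphisms, written as the tuple of images of the variables), and $\mathrm{GL}_n(k)\subset\mathrm{GA}_n(k)$ is the subgroup of linear automorphisms. An element $F\in\mathrm{GA}_n(k)$ is linearizable if it is conjugate in $\mathrm{GA}_n(k)$ to an element of $\mathrm{GL}_n(k)$. $\mathrm{GLIN}_n(k)$ is the subgroup of $\mathrm{GA}_n(k)$ generated by all linearizable automorphisms. $\mathrm{T}_n(k)$ is the tame subgroup of $\mathrm{GA}_n(k)$: the subgroup generated by the affine automorphisms and the elementary automorphisms $(X_1+f,X_2,\ldots,X_n)$ with $f\in k[X_2,\ldots,X_n]$. *)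

(* Defs.v *)
From HB Require Import structures.
From mathcomp Require Import all_boot all_algebra.
From mathcomp Require Export mpoly.

Set Implicit Arguments.
Unset Strict Implicit.
Unset Printing Implicit Defensive.

Import GRing.Theory.
Local Open Scope ring_scope.

(* The identity of k[X_1, ..., X_n], as the tuple of images of the variables. *)
Definition poly_id (k : fieldType) (n : nat) : n.-tuple {mpoly k[n]} :=
  [tuple 'X_i | i < n].

(* A tuple F stands for the k-algebra endomorphism p |-> p \mPo F, which maps
   'X_i to tnth F i; poly_comp F G stands for "G first, then F". *)
Definition poly_comp (k : fieldType) (n : nat) (F G : n.-tuple {mpoly k[n]}) :
    n.-tuple {mpoly k[n]} :=
  [tuple tnth G i \mPo F | i < n].

Lemma poly_compE (k : fieldType) (n : nat) (F G : n.-tuple {mpoly k[n]}) p :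
  p \mPo poly_comp F G = (p \mPo G) \mPo F.
Proof.
rewrite !(comp_mpolyE p) raddf_sum /=; apply: eq_bigr => m _.
rewrite comp_mpolyZ rmorph_prod /=; congr (_ *: _).
by apply: eq_bigr => i _; rewrite rmorphXn /= tnth_mktuple.
Qed.

Lemma poly_compA (k : fieldType) (n : nat) : associative (@poly_comp k n).
Proof.
by move=> F G H; apply: eq_from_tnth => i; rewrite !tnth_mktuple poly_compE.
Qed.

Lemma poly_comp1l (k : fieldType) (n : nat) :
  left_id (poly_id k n) (@poly_comp k n).
Proof.
by move=> F; apply: eq_from_tnth => i; rewrite tnth_mktuple comp_mpoly_id.
Qed.

Lemma poly_comp1r (k : fieldType) (n : nat) :
  right_id (poly_id k n) (@poly_comp k n).
Proof.
move=> F; apply: eq_from_tnth => i.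
by rewrite !tnth_mktuple comp_mpolyXU -tnth_nth.
Qed.

(* Existence of an inverse is not a boolean property, so an automorphism is
   stored with its (unique) inverse; GA_inj shows that the inverse carries no
   information. *)
Record GA (k : fieldType) (n : nat) : Type := MkGA {
  GA_pair : n.-tuple {mpoly k[n]} * n.-tuple {mpoly k[n]};
  GA_pairP : (poly_comp GA_pair.1 GA_pair.2 == poly_id k n) &&
             (poly_comp GA_pair.2 GA_pair.1 == poly_id k n)
}.

HB.instance Definition _ (k : fieldType) (n : nat) :=
  [isSub for @GA_pair k n].
HB.instance Definition _ (k : fieldType) (n : nat) :=
  [Choice of GA k n by <:].

Definition GA_tuple (k : fieldType) (n : nat) (F : GA k n) :
    n.-tuple {mpoly k[n]} :=
  (GA_pair F).1.

Definition GA_img (k : fieldType) (n : nat) (F : GA k n) (i : 'I_n) :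
    {mpoly k[n]} :=
  tnth (GA_tuple F) i.

Lemma GA_inj (k : fieldType) (n : nat) : injective (@GA_tuple k n).
Proof.
move=> [[F F'] /= FP] [[G G'] /= GP]; rewrite /GA_tuple /= => eqFG.
apply: val_inj => /=; move: FP GP; rewrite -{}eqFG.
case/andP=> _ /eqP F'F /andP[/eqP FG' _]; congr (_, _).
by rewrite -[F']poly_comp1r -FG' poly_compA F'F poly_comp1l.
Qed.

Fact GA_one_subproof (k : fieldType) (n : nat) :
  (poly_comp (poly_id k n) (poly_id k n) == poly_id k n) &&
  (poly_comp (poly_id k n) (poly_id k n) == poly_id k n).
Proof. by rewrite poly_comp1l eqxx. Qed.

Definition GA_one (k : fieldType) (n : nat) : GA k n :=
  @MkGA k n (poly_id k n, poly_id k n) (GA_one_subproof k n).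

Fact GA_mul_subproof (k : fieldType) (n : nat) (F G : GA k n) :
  let FG := poly_comp (GA_pair F).1 (GA_pair G).1 in
  let GF' := poly_comp (GA_pair G).2 (GA_pair F).2 in
  (poly_comp FG GF' == poly_id k n) && (poly_comp GF' FG == poly_id k n).
Proof.
case: F G => [[F F'] /= /andP[/eqP FF' /eqP F'F]].
case=> [[G G'] /= /andP[/eqP GG' /eqP G'G]].
rewrite -!poly_compA (poly_compA G G') (poly_compA F' F).
by rewrite GG' F'F !poly_comp1l FF' G'G !eqxx.
Qed.

Definition GA_mul (k : fieldType) (n : nat) (F G : GA k n) : GA k n :=
  @MkGA k n (_, _) (GA_mul_subproof F G).

Fact GA_inv_subproof (k : fieldType) (n : nat) (F : GA k n) :
  (poly_comp (GA_pair F).2 (GA_pair F).1 == poly_id k n) &&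
  (poly_comp (GA_pair F).1 (GA_pair F).2 == poly_id k n).
Proof. by rewrite andbC GA_pairP. Qed.

Definition GA_inv (k : fieldType) (n : nat) (F : GA k n) : GA k n :=
  @MkGA k n (_, _) (GA_inv_subproof F).

Fact GA_mulA (k : fieldType) (n : nat) : associative (@GA_mul k n).
Proof. by move=> F G H; apply: GA_inj; apply: poly_compA. Qed.

Fact GA_mul1 (k : fieldType) (n : nat) : left_id (GA_one k n) (@GA_mul k n).
Proof. by move=> F; apply: GA_inj; apply: poly_comp1l. Qed.

Fact GA_mulr1 (k : fieldType) (n : nat) : right_id (GA_one k n) (@GA_mul k n).
Proof. by move=> F; apply: GA_inj; apply: poly_comp1r. Qed.

Fact GA_mulV (k : fieldType) (n : nat) :
  left_inverse (GA_one k n) (@GA_inv k n) (@GA_mul k n).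
Proof. by move=> F; apply: GA_inj; case/andP: (GA_pairP F) => _ /eqP. Qed.

Fact GA_mulrV (k : fieldType) (n : nat) :
  right_inverse (GA_one k n) (@GA_inv k n) (@GA_mul k n).
Proof. by move=> F; apply: GA_inj; case/andP: (GA_pairP F) => /eqP. Qed.

HB.instance Definition _ (k : fieldType) (n : nat) :=
  isGroup.Build (GA k n) (@GA_mulA k n) (@GA_mul1 k n) (@GA_mulr1 k n)
    (@GA_mulV k n) (@GA_mulrV k n).

Definition GA_aut (k : fieldType) (n : nat) (F : GA k n) :
    {mpoly k[n]} -> {mpoly k[n]} :=
  comp_mpoly (GA_tuple F).

(* F |-> GA_aut F identifies the group GA k n with the k-algebra automorphisms
   of {mpoly k[n]} under composition. *)
Lemma GA_autM (k : fieldType) (n : nat) (F G : GA k n) :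
  GA_aut (F * G)%g =1 GA_aut F \o GA_aut G.
Proof. by move=> p; apply: poly_compE. Qed.

Lemma GA_aut_inj (k : fieldType) (n : nat) (F G : GA k n) :
  GA_aut F =1 GA_aut G -> F = G.
Proof.
move=> eqFG; apply: GA_inj; apply: eq_from_tnth => i.
by have := eqFG 'X_i; rewrite /GA_aut !comp_mpolyXU -!tnth_nth.
Qed.

Lemma GA_aut_bij (k : fieldType) (n : nat) (F : GA k n) : bijective (GA_aut F).
Proof.
case/andP: (GA_pairP F) => /eqP FF' /eqP F'F.
by exists (comp_mpoly (GA_pair F).2) => p;
  rewrite /GA_aut /GA_tuple -poly_compE ?FF' ?F'F comp_mpoly_id.
Qed.

Lemma GA_aut_surj (k : fieldType) (n : nat)
    (phi : {lrmorphism {mpoly k[n]} -> {mpoly k[n]}}) :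
  bijective phi -> exists F : GA k n, GA_aut F =1 phi.
Proof.
case=> psi phiK psiK.
pose F := [tuple phi 'X_i | i < n]; pose G := [tuple psi 'X_i | i < n].
have phiE p : p \mPo F = phi p.
  rewrite [in RHS](mpolyE p) comp_mpolyE raddf_sum; apply: eq_bigr => m _ /=.
  rewrite linearZ /= mpolyXE_id rmorph_prod; congr (_ *: _).
  by apply: eq_bigr => i _; rewrite rmorphXn tnth_mktuple.
have FG : poly_comp F G = poly_id k n.
  by apply: eq_from_tnth => i; rewrite !tnth_mktuple phiE psiK.
have GF : poly_comp G F = poly_id k n.
  apply: eq_from_tnth => i; rewrite !tnth_mktuple.
  by apply: (can_inj phiK); rewrite -phiE -poly_compE FG comp_mpoly_id.
have FP : (poly_comp F G == poly_id k n) && (poly_comp G F == poly_id k n).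
  by rewrite FG GF eqxx.
by exists (@MkGA k n (F, G) FP).
Qed.

Inductive generated (G : groupType) (S : G -> Prop) : G -> Prop :=
| generated_mem x : S x -> generated S x
| generated_one : generated S 1%g
| generated_mul x y : generated S x -> generated S y -> generated S (x * y)%g
| generated_inv x : generated S x -> generated S (x^-1)%g.

Definition linear_aut (k : fieldType) (n : nat) (F : GA k n) : Prop :=
  exists2 A : 'M[k]_n, A \in unitmx &
    forall i : 'I_n, GA_img F i = \sum_(j < n) A i j *: 'X_j.

Definition affine_aut (k : fieldType) (n : nat) (F : GA k n) : Prop :=
  exists A : 'M[k]_n, exists b : 'I_n -> k, A \in unitmx /\
    forall i : 'I_n, GA_img F i = \sum_(j < n) A i j *: 'X_j + (b i)%:MP.

(* The variables are indexed from 0: X_1 is 'X_i with val i = 0. The condition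
   on the support of f says that f lies in k[X_2, ..., X_n]. *)
Definition elementary_aut (k : fieldType) (n : nat) (F : GA k n) : Prop :=
  exists f : {mpoly k[n]},
    (forall m : 'X_{1..n}, m \in msupp f ->
       forall i : 'I_n, val i = 0%N -> m i = 0%N) /\
    (forall i : 'I_n,
       GA_img F i = if val i == 0%N then 'X_i + f else 'X_i).

Definition tame (k : fieldType) (n : nat) : GA k n -> Prop :=
  generated (fun F : GA k n => affine_aut F \/ elementary_aut F).

Definition linearizable (k : fieldType) (n : nat) (F : GA k n) : Prop :=
  exists H : GA k n, linear_aut (F ^ H)%g.

Definition GLIN (k : fieldType) (n : nat) : GA k n -> Prop :=
  generated (@linearizable k n).

(* Main.v *)
Require Import Defs.
From mathcomp Require Import all_boot all_algebra.

Set Implicit Arguments.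
Unset Strict Implicit.
Unset Printing Implicit Defensive.

Import GRing.Theory.
Local Open Scope ring_scope.

(** The reason is that shears are commutators with reflections.  Fix a set J
    of variables and a tuple f of polynomials in the variables outside J, with
    f_i = 0 for i outside J.  The shears U(c) = (X_i + c f_i)_i form a
    one-parameter group, U(a) U(b) = U(a + b), and the linear involution S that
    negates the variables in J inverts it: S U(c) S = U(-c).  When 2 is
    invertible this gives

      U(1) = U(1/2) U(1/2) = (U(1/2) S U(1/2)^-1) S^-1,

    a product of a conjugate of a linear automorphism and a linear automorphism
    (GLIN_shear).

    Both kinds of tame generators reduce to this.  An elementary automorphism is
    the shear U(1) for J consisting of the first variable; a translation is the
    shear U(1) for J consisting of all the variables, and every affine
    automorphism is a linear one times a translation. *)

Section Shears.

Variables (k : fieldType) (n : nat).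
Implicit Types (J : {set 'I_n}) (p : {mpoly k[n]}) (T : n.-tuple {mpoly k[n]}).
Implicit Types (F L S U : GA k n).

Definition free_of J p :=
  forall m : 'X_{1..n}, m \in msupp p -> forall i, i \in J -> m i = 0%N.

Lemma comp_free_of J p T :
  free_of J p -> (forall i, i \notin J -> tnth T i = 'X_i) -> p \mPo T = p.
Proof.
move=> Jp fixT; rewrite comp_mpolyE [RHS]mpolyE.
apply: eq_big_seq => m m_p; rewrite mpolyXE_id; congr (_ *: _).
apply: eq_bigr => i _; have [iJ | /fixT-> //] := boolP (i \in J).
by rewrite (Jp m).
Qed.

Lemma free_of0 J : free_of J 0.
Proof. by move=> m; rewrite msupp0. Qed.

Lemma free_ofC J (c : k) : free_of J c%:MP.
Proof.
move=> m; rewrite msuppC; case: ifP => // _; rewrite inE => /eqP-> i _.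
by rewrite mnm0E.
Qed.

Lemma comp_XU (i : 'I_n) T : 'X_i \mPo T = tnth T i.
Proof. by rewrite comp_mpolyXU -tnth_nth. Qed.

Lemma GA_imgM F G i : GA_img (F * G)%g i = GA_img G i \mPo GA_tuple F.
Proof. exact: tnth_mktuple. Qed.

Lemma eq_GA_img F G : (forall i, GA_img F i = GA_img G i) -> F = G.
Proof. by move=> eqFG; apply/GA_inj/eq_from_tnth. Qed.

(** The time c is kept apart from the direction f so that halving a shear and
    inverting it are both instances of the one-parameter group law. *)
Definition shear_tuple (f : 'I_n -> {mpoly k[n]}) (c : k) :
    n.-tuple {mpoly k[n]} :=
  [tuple 'X_i + c *: f i | i < n].

Definition shear_direction J (f : 'I_n -> {mpoly k[n]}) :=
  (forall i, free_of J (f i)) /\ (forall i, i \notin J -> f i = 0).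

Lemma comp_shear J f c i :
  shear_direction J f -> f i \mPo shear_tuple f c = f i.
Proof.
case=> Jf f0; apply: comp_free_of (Jf i) _ => j jJ.
by rewrite tnth_mktuple f0 // scaler0 addr0.
Qed.

Lemma shear_tupleD J f a b : shear_direction J f ->
  poly_comp (shear_tuple f a) (shear_tuple f b) = shear_tuple f (a + b).
Proof.
move=> Jf; apply: eq_from_tnth => i; rewrite !tnth_mktuple comp_mpolyD.
by rewrite comp_mpolyZ comp_XU tnth_mktuple (comp_shear _ _ Jf) scalerDl addrA.
Qed.

Lemma shear_tuple0 f : shear_tuple f 0 = poly_id k n.
Proof.
by apply: eq_from_tnth => i; rewrite !tnth_mktuple scale0r addr0.
Qed.

Lemma shear_exists J f c :
  shear_direction J f -> exists U, GA_tuple U = shear_tuple f c.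
Proof.
move=> Jf; pose FG := (shear_tuple f c, shear_tuple f (- c)).
suff FGP : (poly_comp FG.1 FG.2 == poly_id k n) &&
           (poly_comp FG.2 FG.1 == poly_id k n) by exists (MkGA FGP).
by rewrite !(shear_tupleD _ _ Jf) subrr addNr shear_tuple0 eqxx.
Qed.

Definition reflection_tuple J : n.-tuple {mpoly k[n]} :=
  [tuple (-1) ^+ (i \in J) *: 'X_i | i < n].

Lemma reflection_exists J : exists S, GA_tuple S = reflection_tuple J.
Proof.
have SS : poly_comp (reflection_tuple J) (reflection_tuple J) = poly_id k n.
  apply: eq_from_tnth => i; rewrite !tnth_mktuple comp_mpolyZ comp_XU.
  by rewrite tnth_mktuple scalerA -signr_addb addbb scale1r.
pose FG := (reflection_tuple J, reflection_tuple J).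
suff FGP : (poly_comp FG.1 FG.2 == poly_id k n) &&
           (poly_comp FG.2 FG.1 == poly_id k n) by exists (MkGA FGP).
by rewrite SS eqxx.
Qed.

Lemma reflection_linear J S : GA_tuple S = reflection_tuple J -> linear_aut S.
Proof.
move=> defS; exists (diag_mx (\row_i (-1) ^+ (i \in J))).
  rewrite unitmxE det_diag unitr_prod // => i _.
  by rewrite mxE unitrX // unitrN1.
move=> i; rewrite /GA_img defS tnth_mktuple (bigD1 i) //= big1 => [|j ji].
  by rewrite !mxE eqxx mulr1n addr0.
by rewrite !mxE eq_sym (negPf ji) mulr0n scale0r.
Qed.

Lemma GLIN_conj_linear L H : linear_aut L -> GLIN (L ^ H)%g.
Proof.
by move=> linL; apply: generated_mem; exists H^-1%g; rewrite conjgK.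
Qed.

Lemma GLIN_linear L : linear_aut L -> GLIN L.
Proof. by move=> linL; rewrite -[L]conjg1; apply: GLIN_conj_linear. Qed.

(** A shear is the commutator of its half with the reflection that inverts
    it. *)
Lemma GLIN_shear J f U : (2%:R : k) != 0 -> shear_direction J f ->
  GA_tuple U = shear_tuple f 1 -> GLIN U.
Proof.
move=> nz2 Jf defU; have [S defS] := reflection_exists J.
have [V defV] := shear_exists (2%:R^-1) Jf.
have linS := reflection_linear defS.
suff -> : U = ((S ^ V^-1) * S^-1)%g.
  apply: generated_mul; first exact: GLIN_conj_linear.
  by apply: generated_inv; apply: GLIN_linear.
suff USV : (U * (S * V) = V * S)%g.
  by rewrite conjgE invgK (mulgA V) -USV !mulgA !mulgK.
have half_f i : f i = 2%:R^-1 *: f i + 2%:R^-1 *: f i.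
  by rewrite -scalerDl -mulr2n -(mulr_natr 2%:R^-1) mulVf // scale1r.
apply: eq_GA_img => i; rewrite !GA_imgM /GA_img defS defV defU.
rewrite !tnth_mktuple !(comp_mpolyD, comp_mpolyZ) !comp_XU !tnth_mktuple.
have fS : f i \mPo reflection_tuple J = f i.
  by case: Jf => /(_ i)/comp_free_of + _; apply=> j jJ;
    rewrite tnth_mktuple (negPf jJ) scale1r.
rewrite fS !comp_mpolyZ comp_XU tnth_mktuple (comp_shear _ _ Jf) scale1r.
have [iJ | /(proj2 Jf)->] := boolP (i \in J); last by rewrite !scaler0 !addr0.
by rewrite !scaleN1r {1}half_f !opprD !addrA addrNK.
Qed.

Lemma GLIN_elementary F : (2%:R : k) != 0 -> elementary_aut F -> GLIN F.
Proof.
move=> nz2 [f [f_free defF]].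
pose d (i : 'I_n) := if val i == 0%N then f else 0.
apply: (@GLIN_shear [set i | val i == 0%N] d) => //.
  split=> i; rewrite /d; last by rewrite inE => /negPf->.
  case: ifP => _; last exact: free_of0.
  by move=> m /f_free fm j; rewrite inE => /eqP/fm.
apply: eq_from_tnth => i; rewrite tnth_mktuple [LHS]defF scale1r /d.
by case: ifP => //; rewrite addr0.
Qed.

(** Composing with the translation by -b removes the constant terms and keeps
    the matrix, so no linear automorphism has to be built from A. *)
Lemma GLIN_affine F : (2%:R : k) != 0 -> affine_aut F -> GLIN F.
Proof.
move=> nz2 [A [b [uA defF]]]; pose d i : {mpoly k[n]} := (- b i)%:MP.
have Td : shear_direction setT d.
  by split=> i; [apply: free_ofC | rewrite inE].
have [T defT] := shear_exists 1 Td.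
rewrite -[F](mulgK T); apply: generated_mul; last first.
  by apply: generated_inv; apply: GLIN_shear nz2 Td defT.
apply: GLIN_linear; exists A => // i; rewrite GA_imgM /GA_img defT tnth_mktuple.
rewrite scale1r comp_mpolyD comp_XU comp_mpolyC [tnth _ _]defF.
by rewrite mpolyCN addrK.
Qed.

End Shears.

Theorem lemma4p2 (k : fieldType) (n : nat)
    (char_neq2 : 2%N \notin [pchar k]%R) (n_ge1 : (1 <= n)%N) :
  forall F : GA k n, tame F -> GLIN F.
Proof.
have nz2 : (2%:R : k) != 0 by apply: contra char_neq2; rewrite inE.
move=> F; elim=> {F} [F [|] | | F G _ IHF _ IHG | F _ IHF].
- exact: GLIN_affine.
- exact: GLIN_elementary.
- exact: generated_one.
- exact: generated_mul.
- exact: generated_inv.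
Qed.
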